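(* For all integers $k \geq 3$ and $h_1 \geq 1$, there exist finite sets of integers $A$ and $B$ with $|A| = |B| = k$ such that $|hB| = |hA|$ for all positive integers $h \leq h_1$, and $|hB| = |hA| + h - h_1 > |hA|$ for all integers $h \geq h_1 + 1$.
   Context: For a nonempty finite set $A$ of integers and a positive integer $h$, the $h$-fold sumset $hA$ is the set of all sums of $h$ not necessarily distinct elements of $A$, and $|hA|$ denotes its cardinality. *)

(* Defs.v *)
From mathcomp Require Export all_boot all_order all_algebra finmap.

Set Implicit Arguments.
Unset Strict Implicit.
Unset Printing Implicit Defensive.

Import GRing.Theory.

Local Open Scope fset_scope.
Local Open Scope ring_scope.

(* f is not required to be injective, so summands may be repeated. *)
Definition hfold_sumset (h : nat) (A : {fset int}) : {fset int} :=
  [fset \sum_(i < h) val (f i) | f : {ffun 'I_h -> A} in predT].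

(* Main.v *)
Require Import Defs.
From mathcomp Require Import zify.

(* Take the interval [0, m], m = k - 2, together with one further point N > m.
   The elements of its h-fold sumset below N form an interval of length
   min(N, h m + 1), and those from N on are the translate by N of the
   (h - 1)-fold sumset, so the h-fold sumset has \sum_(i <= h) min(N, i m + 1)
   elements.  Raising N from h1 m + 1 to h1 m + 2 increases by one exactly the
   terms with i > h1. *)

Local Open Scope fset_scope.
Local Open Scope nat_scope.

Lemma hfold_sumset0 (A : {fset int}) : hfold_sumset 0 A = [fset 0%R].
Proof.
apply/fsetP => x; rewrite in_fset1; apply/imfsetP/eqP => [[f _ ->]|->].
  by rewrite big_ord0.
have f0 : 'I_0 -> A by case.
by exists [ffun i => f0 i]; rewrite ?big_ord0.
Qed.

Lemma mem_hfold_sumsetS h (A : {fset int}) (x : int) :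
  x \in hfold_sumset h.+1 A <->
  exists a y, [/\ a \in A, y \in hfold_sumset h A & x = (a + y)%R].
Proof.
split=> [/imfsetP[f _ ->]|[a [_ [aA /imfsetP[f _ ->] ->]]]].
  rewrite big_ord_recl; exists (val (f ord0)).
  exists (\sum_(i < h) val (f (lift ord0 i)))%R; split=> //; first exact: valP.
  apply/imfsetP; exists [ffun i => f (lift ord0 i)] => //.
  by apply: eq_bigr => i _; rewrite ffunE.
apply/imfsetP.
(* The new summand [a] takes index 0 and the given summands are shifted up by one. *)
exists [ffun i => if unlift ord0 i is Some j then f j else [` aA]] => //.
rewrite big_ord_recl ffunE unlift_none; congr (_ + _)%R.
by apply: eq_bigr => i _; rewrite ffunE liftK.
Qed.

(** Listing the points in a sequence reduces their count to its having no duplicates, which holds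
    once [m < N]. *)
Definition interval_point (m N : nat) : {fset int} :=
  [fset Posz i | i in N :: iota 0 m.+1].

Lemma mem_interval_point m N x :
  x \in interval_point m N <-> exists2 i, i <= m \/ i = N & x = Posz i.
Proof.
have memE i : (i \in N :: iota 0 m.+1) = (i == N) || (i <= m).
  by rewrite in_cons mem_iota.
split=> [/imfsetP[i iP ->]|[i iP ->]].
  by exists i => //; move: iP; rewrite memE; lia.
by apply/imfsetP; exists i => //; rewrite [_ \in _]memE; lia.
Qed.

Lemma card_interval_point m N : m < N -> #|` interval_point m N| = m.+2.
Proof.
move=> ltmN; rewrite card_imfset => [|i j []//].
rewrite [enum_finmem _]undup_id; first by rewrite /= size_iota.
by rewrite cons_uniq iota_uniq mem_iota; lia.
Qed.

(** Here [j] counts the summands taken to be [N]; the other [h - j] range over [0, m], so their sum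
    takes every value up to [(h - j) * m]. The pair [j], [r] need not be unique. *)
Lemma mem_hfold_interval_point m N h x :
  x \in hfold_sumset h (interval_point m N) <->
  exists j r : nat, [/\ j <= h, r <= (h - j) * m & x = Posz (j * N + r)].
Proof.
elim: h x => [|h IHh] x.
  rewrite hfold_sumset0 in_fset1; split=> [/eqP ->|]; first by exists 0, 0.
  move=> [j [r [j0 r0 ->]]]; apply/eqP; congr Posz; nia.
split=> [/mem_hfold_sumsetS[a [y [/mem_interval_point[i iP ->] /IHh]]]|].
  move=> [j [r [jh rP ->]]] ->; case: iP => [im|->].
    by exists j, (i + r); split; [lia | rewrite subSn // mulSn; lia | lia].
  by exists j.+1, r; split; rewrite ?subSS // mulSn; lia.
move=> [j [r [jh rP ->]]]; apply/mem_hfold_sumsetS; case: j => [|j] in jh rP *.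
  (* No summand is forced to be [N], so peel off greedily the largest summand of [0, m]; the
     truncated [r - m] remains. *)
  exists (Posz (minn r m)), (Posz (r - m)); split; last by lia.
  - by apply/mem_interval_point; exists (minn r m); lia.
  - apply/IHh; exists 0, (r - m); split=> //.
    by rewrite !subn0 mulSn in rP *; lia.
exists (Posz N), (Posz (j * N + r)); split; last by rewrite mulSn; lia.
- by apply/mem_interval_point; exists N; [right|].
- by apply/IHh; exists j, r.
Qed.

Lemma card_hfold_interval_pointS m N h : m < N ->
  #|` hfold_sumset h.+1 (interval_point m N)| =
  minn N (h.+1 * m).+1 + #|` hfold_sumset h (interval_point m N)|.
Proof.
move=> ltmN; set H := hfold_sumset h _.
pose I := [fset Posz i | i in iota 0 (minn N (h.+1 * m).+1)].
pose J := [fset (Posz N + x)%R | x in H].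
have -> : hfold_sumset h.+1 (interval_point m N) = I `|` J.
  apply/fsetP => x; apply/idP/fsetUP.
    move=> /mem_hfold_interval_point[[|j] [r [jh rP ->]]].
      have [ltrN|leNr] := ltnP r N; [left|right]; apply/imfsetP => /=.
        by exists r; rewrite // mem_iota; lia.
      (* Since [N > m], [r <= h.+1 * m] gives [r - N <= h * m], so even a sum without [N] lies in
         the translate as soon as it reaches [N]. *)
      exists (Posz (r - N)); last by lia.
      apply/mem_hfold_interval_point; exists 0, (r - N); split=> //.
      by rewrite !subn0 mulSn in rP *; lia.
    right; apply/imfsetP; exists (Posz (j * N + r)) => /=.
      by apply/mem_hfold_interval_point; exists j, r.
    by rewrite mulSn; lia.
  move=> [] /imfsetP /= [y yP ->]; apply/mem_hfold_interval_point.
    by exists 0, y; rewrite mem_iota in yP; split=> //; lia.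
  move/mem_hfold_interval_point: yP => [j [r [jh rP ->]]].
  by exists j.+1, r; split; rewrite ?subSS // mulSn; lia.
(* [I] lies below [N], while the elements of [H] are nonnegative, so [J] starts at [N] or later. *)
have dIJ : [disjoint I & J].
  apply/fdisjointP => x /imfsetP /= [i iP ->]; apply/imfsetP => /= -[y].
  move=> /mem_hfold_interval_point[j [r [_ _ ->]]].
  by move: iP; rewrite mem_iota; lia.
have /eqP-> : #|` I `|` J| == #|` I| + #|` J|.
  by rewrite (leq_card_fsetU I J).2.
congr (_ + _); last by rewrite card_imfset // => x y; apply: GRing.addrI.
rewrite card_imfset => [|i j []//].
by rewrite [enum_finmem _]undup_id ?iota_uniq // size_iota.
Qed.

Lemma card_hfold_interval_point m N h : m < N ->
  #|` hfold_sumset h (interval_point m N)| =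
  \sum_(i < h.+1) minn N (i * m).+1.
Proof.
move=> ltmN; elim: h => [|h IHh].
  by rewrite hfold_sumset0 cardfs1 big_ord1 mul0n; lia.
by rewrite card_hfold_interval_pointS // IHh [RHS]big_ord_recr addnC.
Qed.

(** The truncated [h - h1] vanishes for [h <= h1], so one formula serves both ranges of the
    theorem. *)
Lemma sum_minn_succ m h1 h : 0 < m ->
  \sum_(i < h.+1) minn (h1 * m).+2 (i * m).+1 =
  \sum_(i < h.+1) minn (h1 * m).+1 (i * m).+1 + (h - h1).
Proof.
move=> m_gt0; elim: h => [|h IHh]; first by rewrite !big_ord1 mul0n; lia.
rewrite big_ord_recr [in RHS]big_ord_recr /= {}IHh; move: (\sum_(_ < _) _) => S.
(* If [h.+1 <= h1], both new minima are [(h.+1 * m).+1]. Otherwise [m > 0] gives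
   [(h1 * m).+2 <= (h.+1 * m).+1], so both caps are attained and differ by one. *)
have [leh|lth] := leqP h.+1 h1.
  by have := leq_mul leh (leqnn m); lia.
by have := leq_mul lth (leqnn m); rewrite mulSn; lia.
Qed.

Theorem theorem8 (k h1 : nat) (hk : 3 <= k) (hh1 : 1 <= h1) :
  exists A B : {fset int},
    [/\ #|` A| = k,
        #|` B| = k,
        (forall h : nat, 0 < h -> h <= h1 ->
           #|` hfold_sumset h B| = #|` hfold_sumset h A|)
      & (forall h : nat, h1 + 1 <= h ->
           #|` hfold_sumset h B| = #|` hfold_sumset h A| + h - h1 /\
           #|` hfold_sumset h B| > #|` hfold_sumset h A|)].
Proof.
have [m m_gt0 ->] : exists2 m, 0 < m & k = m.+2 by exists k.-2; lia.
(* [h1 >= 1] is what places the extra point beyond the interval. *)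
have ltA : m < (h1 * m).+1 by rewrite ltnS leq_pmull.
have ltB : m < (h1 * m).+2 by apply: leqW.
exists (interval_point m (h1 * m).+1), (interval_point m (h1 * m).+2).
split; try exact: card_interval_point.
  by move=> h _ leh; rewrite !card_hfold_interval_point // sum_minn_succ; lia.
by move=> h lth; rewrite !card_hfold_interval_point // sum_minn_succ; lia.
Qed.
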